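(* Let $\hat{\mathbf{u}}^t=\mathrm{col}(\hat u_0^t,\dots,\hat u_{L'-1}^t)\in\mathbb{R}^{n_uL'}$ be the input sequence to be designed at time $t$, let $\hat{\mathbf{y}}^t=\mathrm{col}(\hat y_0^t,\dots,\hat y_{L'-1}^t)$ be the random output prediction with mean $\bar{\mathbf{y}}^t$ and covariance $\Sigma^t$ given by the stochastic data-driven predictor (defined in the context), let $r_t,\dots,r_{t+L'-1}\in\mathbb{R}^{n_y}$ be a reference trajectory, and let $Q$ and $R$ be the output and input cost matrices. Then the expected control cost $$J_t:=\sum_{k=0}^{L'-1}\|\hat u_k^t\|_R^2+\mathbb{E}\left[\sum_{k=0}^{L'-1}\|\hat y_k^t-r_{t+k}\|_Q^2\right]$$ is given by $$J_t=\|\hat{\mathbf{u}}^t\|_{\bar R}^2+\|\bar{\mathbf{y}}^t-\mathbf{r}^t\|_{\bar Q}^2+\mathrm{tr}(\bar Q T)\,\|g^t\|_2^2+\text{constant},$$ where $\bar R:=\mathbb{I}_{L'}\otimes R$, $\bar Q:=\mathbb{I}_{L'}\otimes Q$, $\mathbf{r}^t:=\mathrm{col}(r_t,\dots,r_{t+L'-1})$ and $T:=\sigma^2(\Gamma\Gamma^\top+\mathbb{I}_{n_yL'})$. The cost is quadratic with respect to the optimization variable $\hat{\mathbf{u}}^t$.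
   Context: Notation: $\mathrm{col}(\cdot)$ is vertical stacking; $\|x\|_P:=(x^\top Px)^{1/2}$; $\otimes$ is the Kronecker product; $\dagger$ is the pseudoinverse. System: the observable part of a stable linear time-invariant system $x_{t+1}=Ax_t+Bu_t+Ew_t$, $y_t=Cx_t+Du_t+v_t$, with inputs $u_t\in\mathbb{R}^{n_u}$, disturbances $w_t\in\mathbb{R}^{n_w}$, outputs $y_t\in\mathbb{R}^{n_y}$, and zero-mean i.i.d. output noise $v_t$ with covariance $\sigma^2\mathbb{I}_{n_y}$. The matrices $A,B,C,D,E$ are unknown. $L=L_0+L'$, where $L'$ is the control horizon and $L_0$ is no smaller than the observability index of the system. Data: $M$ offline length-$L$ trajectories, arranged as columns, with independent output noise in different columns, give $\Psi\in\mathbb{R}^{(n_u+n_w)L\times M}$ (inputs stacked over disturbances), $Y_p\in\mathbb{R}^{n_yL_0\times M}$ and $Y_f\in\mathbb{R}^{n_yL'\times M}$ (the first $L_0$ and last $L'$ block rows of the noisy outputs). Prediction conditions at time $t$: past inputs $\mathbf{u}_{\rm ini}^t\in\mathbb{R}^{n_uL_0}$ over times $t-L_0,\dots,t-1$; mean $\bar{\mathbf{w}}^t$ and covariance $\Sigma_w$ of the disturbance sequence over times $t-L_0,\dots,t+L'-1$; mean $\bar{\mathbf{y}}_{\rm ini}^t$ and covariance $P_t$ of the output sequence over times $t-L_0,\dots,t-1$. Predictor: with design parameters $\lambda$ and $S$, $g^t$ is the minimizer over $g$ of $\|Y_pg-\bar{\mathbf{y}}_{\rm ini}^t\|_S^2+\lambda\|g\|_2^2$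 subject to $\Psi g=\mathrm{col}(\mathbf{u}_{\rm ini}^t,\hat{\mathbf{u}}^t,\bar{\mathbf{w}}^t)$. It has the closed form $$g^t=[R_1\ R_2\ R_3\ R_4]\,\mathrm{col}(\mathbf{u}_{\rm ini}^t,\hat{\mathbf{u}}^t,\bar{\mathbf{w}}^t,\bar{\mathbf{y}}_{\rm ini}^t),$$ where $F:=\lambda\mathbb{I}_M+Y_p^\top SY_p$, $$[R_1\ R_2\ R_3]:=F^{-1}\Psi^\top(\Psi F^{-1}\Psi^\top)^{-1},\qquad R_4:=\left(F^{-1}-F^{-1}\Psi^\top(\Psi F^{-1}\Psi^\top)^{-1}\Psi F^{-1}\right)Y_p^\top S,$$ and $R_1,R_2,R_3$ have $n_uL_0$, $n_uL'$, $n_wL$ columns respectively. The choices of $(S,\lambda)$ listed as having been proposed are: (1) subspace predictor: $S=\mathbb{I}_{n_yL_0}$, $\lambda\to0^+$; (2) Wasserstein distance minimization: $S=\mathbb{I}_{n_yL_0}$, $\lambda=n_yL_0\sigma^2$; (3) signal matrix model: $S=\mathbb{I}_{n_yL_0}$, $\lambda=n_y(L\sigma^2+L'\sigma^2/\|g_{\rm pinv}^t\|_2^2)$ with $g_{\rm pinv}^t=\mathrm{col}(\Psi,Y_p)^\dagger\,\mathrm{col}(\mathbf{u}_{\rm ini}^t,\hat{\mathbf{u}}^t,\bar{\mathbf{w}}^t,\bar{\mathbf{y}}_{\rm ini}^t)$; (4) minimum mean-squared error: $S=\bar\Gamma^\top\bar\Gamma$, $\lambda=n_yL'\sigma^2+\mathrm{tr}(S)\sigma^2$,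 with $\bar\Gamma$ the last $n_yL_0$ columns of $Y_f\,\mathrm{col}(\Psi,Y_p)^\dagger$. The matrix $\Gamma:=\mathrm{col}(CA^{L_0},\dots,CA^{L-1})\,\mathrm{col}(C,\dots,CA^{L_0-1})^\dagger$ is the autonomous transformation matrix from past to future outputs; since $A,C$ are unknown, it is assumed throughout that $\Gamma$ equals its data-driven estimate $Y_fR_4(Y_pR_4)^{-1}$. Put $\Gamma_w:=(Y_f-\Gamma Y_p)R_3$. The random vector $\hat{\mathbf{y}}^t$ satisfies $$\mathbb{E}[\hat{\mathbf{y}}^t\mid g^t]=\bar{\mathbf{y}}^t:=Y_fg^t-\Gamma(Y_pg^t-\bar{\mathbf{y}}_{\rm ini}^t),\qquad \mathrm{cov}(\hat{\mathbf{y}}^t\mid g^t)=\Sigma^t:=\Gamma P_t\Gamma^\top+\Gamma_w\Sigma_w\Gamma_w^\top+\|g^t\|_2^2\,T,$$ and the expectation in $J_t$ is taken with respect to this mean and covariance.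
   Formalization: That the cost is quadratic in the input is asserted only when λ does not depend on the designed input (λ→0+ included); for the signal matrix model's λ, which depends on it through g_pinv, that claim is false, and only the cost formula is asserted. *)

(* Defs.v *)
From HB Require Import structures.
From mathcomp Require Import all_boot all_order all_algebra.
From mathcomp Require Import complex mxtens.
From mathcomp Require Import all_classical all_reals all_analysis.
Set Implicit Arguments.
Unset Strict Implicit.
Unset Printing Implicit Defensive.
Import Order.TTheory GRing.Theory Num.Theory.
Import numFieldNormedType.Exports.
Local Open Scope classical_set_scope.
Local Open Scope ring_scope.

(* A stacked vector col(x_0, ..., x_(L-1)) with x_k in R^n has type
   'cV_(L * n); its entry (k, i) sits at mxtens_index (k, i) = k * n + i, the
   indexing of the Kronecker product tensmx. *)
Definition stack (R : realType) (L n : nat) (x : 'I_L -> 'cV[R]_n) :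
    'cV[R]_(L * n) :=
  \col_i x (mxtens_unindex i).1 (mxtens_unindex i).2 0.

Definition block (R : realType) (L n : nat) (x : 'cV[R]_(L * n)) (k : 'I_L) :
    'cV[R]_n :=
  \col_i x (mxtens_index (k, i)) 0.

Definition psd (R : realType) (n : nat) (P : 'M[R]_n) : Prop :=
  P^T = P /\ forall x : 'cV[R]_n, 0 <= (x^T *m P *m x) 0 0.

Definition wnorm (R : realType) (n : nat) (P : 'M[R]_n) (x : 'cV[R]_n) : R :=
  Num.sqrt ((x^T *m P *m x) 0 0).

Definition norm2 (R : realType) (n : nat) (x : 'cV[R]_n) : R :=
  Num.sqrt (\sum_i x i 0 ^+ 2).

(* The library's pinvmx is only a partial inverse on the row space, not the
   Moore-Penrose pseudoinverse. *)
Definition moore_penrose (R : realType) (m n : nat)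
    (A : 'M[R]_(m, n)) (X : 'M[R]_(n, m)) : Prop :=
  [/\ A *m X *m A = A, X *m A *m X = X,
      (A *m X)^T = A *m X & (X *m A)^T = X *m A].

Definition mp_pinv (R : realType) (m n : nat) (A : 'M[R]_(m, n)) :
    'M[R]_(n, m) :=
  xget 0 [set X | moore_penrose A X].

Definition schur_stable (R : realType) (n : nat) (A : 'M[R]_n) : Prop :=
  forall z : R[i], eigenvalue (map_mx (real_complex R) A) z -> `|z| < 1.

(* col(C A^a, ..., C A^(a + L - 1)) *)
Definition obs_mx (R : realType) (nx ny : nat)
    (A : 'M[R]_nx) (C : 'M[R]_(ny, nx)) (a L : nat) : 'M[R]_(L * ny, nx) :=
  \matrix_(i, j)
    (C *m (A ^+ (a + (mxtens_unindex i).1))) (mxtens_unindex i).2 j.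

(* Gamma: the map from past to future outputs of x_(t+1) = A x_t, y_t = C x_t *)
Definition auto_mx (R : realType) (nx ny : nat)
    (A : 'M[R]_nx) (C : 'M[R]_(ny, nx)) (L0 L' : nat) :
    'M[R]_(L' * ny, L0 * ny) :=
  obs_mx A C L0 L' *m mp_pinv (obs_mx A C 0 L0).

Definition F_mx (R : realType) (m M : nat)
    (Yp : 'M[R]_(m, M)) (S : 'M[R]_m) (lambda : R) : 'M[R]_M :=
  lambda%:M + Yp^T *m S *m Yp.

(* The closed-form minimizer of
   ||Y_p g - y||_S^2 + lambda ||g||_2^2 subject to Psi g = d
   is gain_Psi *m d + gain_y *m y; gain_Psi is [R_1 R_2 R_3] and gain_y is
   R_4. *)
Definition gain_Psi (R : realType) (p m M : nat)
    (Psi : 'M[R]_(p, M)) (Yp : 'M[R]_(m, M)) (S : 'M[R]_m) (lambda : R) :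
    'M[R]_(M, p) :=
  let Fi := invmx (F_mx Yp S lambda) in
  Fi *m Psi^T *m invmx (Psi *m Fi *m Psi^T).

Definition gain_y (R : realType) (p m M : nat)
    (Psi : 'M[R]_(p, M)) (Yp : 'M[R]_(m, M)) (S : 'M[R]_m) (lambda : R) :
    'M[R]_(M, m) :=
  let Fi := invmx (F_mx Yp S lambda) in
  (Fi - Fi *m Psi^T *m invmx (Psi *m Fi *m Psi^T) *m Psi *m Fi) *m Yp^T *m S.

(* The regularization parameter lambda is either a positive weight, which may
   depend on the designed input (the signal matrix model chooses lambda through
   col(Psi, Y_p)^+ col(u_ini, u, w, y_ini)), or the limit lambda -> 0+ of the
   subspace predictor. *)
Variant regularization (R : realType) (n : nat) : Type :=
  | Weight of ('cV[R]_n -> R)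
  | ZeroPlus.
Arguments ZeroPlus {R n}.

Definition reg_positive (R : realType) (n : nat) (reg : regularization R n) :
    Prop :=
  if reg is Weight lambda then forall u, 0 < lambda u else True.

Definition reg_constant (R : realType) (n : nat) (reg : regularization R n) :
    Prop :=
  if reg is Weight lambda then forall u v, lambda u = lambda v else True.

Definition at_reg (R : realType) (n p q : nat) (reg : regularization R n)
    (f : R -> 'M[R]_(p, q)) (u : 'cV[R]_n) : 'M[R]_(p, q) :=
  match reg with
  | Weight lambda => f (lambda u)
  | ZeroPlus => lim (f lambda @[lambda --> 0^'+])
  end.

Definition R3_mx (R : realType) (n pu pw m M : nat)
    (Psi : 'M[R]_(pu + pw, M)) (Yp : 'M[R]_(m, M)) (S : 'M[R]_m)
    (reg : regularization R n) (u : 'cV[R]_n) : 'M[R]_(M, pw) :=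
  rsubmx (at_reg reg (gain_Psi Psi Yp S) u).

Definition R4_mx (R : realType) (n p m M : nat)
    (Psi : 'M[R]_(p, M)) (Yp : 'M[R]_(m, M)) (S : 'M[R]_m)
    (reg : regularization R n) (u : 'cV[R]_n) : 'M[R]_(M, m) :=
  at_reg reg (gain_y Psi Yp S) u.

Definition is_minimizer (R : realType) (p m M : nat)
    (Psi : 'M[R]_(p, M)) (Yp : 'M[R]_(m, M)) (S : 'M[R]_m)
    (lambda : R) (d : 'cV[R]_p) (y : 'cV[R]_m) (g : 'cV[R]_M) : Prop :=
  let obj h := wnorm S (Yp *m h - y) ^+ 2 + lambda * norm2 h ^+ 2 in
  Psi *m g = d /\ forall h, Psi *m h = d -> obj g <= obj h.

Definition is_predictor (R : realType) (n p m M : nat)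
    (Psi : 'M[R]_(p, M)) (Yp : 'M[R]_(m, M)) (S : 'M[R]_m)
    (reg : regularization R n) (d : 'cV[R]_n -> 'cV[R]_p) (y : 'cV[R]_m)
    (u : 'cV[R]_n) (g : 'cV[R]_M) : Prop :=
  match reg with
  | Weight lambda => is_minimizer Psi Yp S (lambda u) (d u) y g
  | ZeroPlus => exists h : R -> 'cV[R]_M,
      (forall lambda, 0 < lambda ->
         is_minimizer Psi Yp S lambda (d u) y (h lambda)) /\
      h lambda @[lambda --> 0^'+] --> g
  end.

Definition pred_mean (R : realType) (mp mf M : nat)
    (Yp : 'M[R]_(mp, M)) (Yf : 'M[R]_(mf, M)) (Gam : 'M[R]_(mf, mp))
    (y : 'cV[R]_mp) (g : 'cV[R]_M) : 'cV[R]_mf :=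
  Yf *m g - Gam *m (Yp *m g - y).

(* The contribution of the output noise to the covariance is ||g||_2^2 T. *)
Definition noise_mx (R : realType) (mp mf : nat)
    (sigma : R) (Gam : 'M[R]_(mf, mp)) : 'M[R]_mf :=
  sigma ^+ 2 *: (Gam *m Gam^T + 1%:M).

(* Sigma^t, with Gamma_w = (Y_f - Gamma Y_p) R_3 *)
Definition pred_cov (R : realType) (pw mp mf M : nat)
    (sigma : R) (Yp : 'M[R]_(mp, M)) (Yf : 'M[R]_(mf, M))
    (Gam : 'M[R]_(mf, mp)) (R3 : 'M[R]_(M, pw))
    (Pt : 'M[R]_mp) (Sw : 'M[R]_pw) (g : 'cV[R]_M) : 'M[R]_mf :=
  let Gamw := (Yf - Gam *m Yp) *m R3 in
  Gam *m Pt *m Gam^T + Gamw *m Sw *m Gamw^T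
    + norm2 g ^+ 2 *: noise_mx sigma Gam.

Definition has_mean_cov (R : realType) (d : measure_display)
    (Omega : measurableType d) (P : probability Omega R) (n : nat)
    (Y : Omega -> 'cV[R]_n) (mu : 'cV[R]_n) (Sig : 'M[R]_n) : Prop :=
  [/\ forall i, (fun w => Y w i 0) \in Lfun P 2%:E,
      forall i, 'E_P[fun w => (Y w i 0)%R]%E = (mu i 0)%:E
    & forall i j,
        covariance P (fun w => Y w i 0) (fun w => Y w j 0) = (Sig i j)%:E].

(* J_t, an extended real since the expectation is one in the library *)
Definition control_cost (R : realType) (d : measure_display)
    (Omega : measurableType d) (P : probability Omega R) (L nu ny : nat)
    (Q : 'M[R]_ny) (Rc : 'M[R]_nu) (r : 'I_L -> 'cV[R]_ny)
    (u : 'cV[R]_(L * nu)) (Y : Omega -> 'cV[R]_(L * ny)) : \bar R :=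
  ((\sum_(k < L) wnorm Rc (block u k) ^+ 2)%R%:E
   + 'E_P[fun w => (\sum_(k < L) wnorm Q (block (Y w) k - r k) ^+ 2)%R])%E.

Definition quadratic (R : realType) (n : nat) (f : 'cV[R]_n -> \bar R) :
    Prop :=
  exists (H : 'M[R]_n) (h : 'cV[R]_n) (c : R), forall u,
    f u = ((u^T *m H *m u) 0 0 + (h^T *m u) 0 0 + c)%:E.

(* Main.v *)
(* The expectation of a quadratic form is its value at the mean plus the trace
   against the covariance, so when lambda depends on the input only
   tr(Qbar Gamma_w Sigma_w Gamma_w^T) could fail to be constant. But
   [R_1 R_2 R_3] = Psi^+ - R_4 Y_p Psi^+ for every lambda, and Y_f - Gamma Y_p
   annihilates R_4 by the choice of Gamma, so Gamma_w does not depend on lambda.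
   For constant lambda, minimizers are the unique solutions of a stationarity
   condition affine in (g, d); hence g^t is affine in the input, and so is its
   limit as lambda -> 0+. *)
Require Import Defs.
From HB Require Import structures.
From mathcomp Require Import all_boot all_order all_algebra.
From mathcomp Require Import ring lra.
From mathcomp Require Import complex mxtens.
From mathcomp Require Import all_classical all_reals all_analysis.
Set Implicit Arguments.
Unset Strict Implicit.
Unset Printing Implicit Defensive.
Import Order.TTheory GRing.Theory Num.Theory.
Import numFieldNormedType.Exports.
Local Open Scope classical_set_scope.
Local Open Scope ring_scope.

Section QuadraticForms.
Context (R : realType).

Lemma form_sum (n : nat) (N : 'M[R]_n) (x y : 'cV[R]_n) :
  (x^T *m N *m y) 0 0 = \sum_i \sum_j N i j * (x i 0 * y j 0).
Proof.
rewrite mxE exchange_big /=; apply: eq_bigr => j _.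
rewrite mxE mulr_suml; apply: eq_bigr => i _.
by rewrite mxE mulrCA mulrA.
Qed.

Lemma form_tr (n : nat) (N : 'M[R]_n) (x y : 'cV[R]_n) :
  (x^T *m N *m y) 0 0 = (y^T *m N^T *m x) 0 0.
Proof.
have -> : y^T *m N^T *m x = (x^T *m N *m y)^T by rewrite !trmx_mul trmxK mulmxA.
by rewrite [RHS]mxE.
Qed.

Lemma form_shift (n : nat) (N : 'M[R]_n) (x y : 'cV[R]_n) (s : R) : N^T = N ->
  ((x + s *: y)^T *m N *m (x + s *: y)) 0 0 =
  (x^T *m N *m x) 0 0 + s * (2 * (y^T *m N *m x) 0 0) +
    s ^+ 2 * (y^T *m N *m y) 0 0.
Proof.
move=> sN; have := form_tr N x y; rewrite sN => xy.
have -> : (x + s *: y)^T *m N *m (x + s *: y) =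
  x^T *m N *m x + s *: (x^T *m N *m y) + s *: (y^T *m N *m x) +
    s ^+ 2 *: (y^T *m N *m y).
  have -> : (x + s *: y)^T = x^T + s *: y^T.
    by apply/matrixP => i j; rewrite !mxE.
  rewrite !mulmxDl !mulmxDr -!scalemxAl -!scalemxAr.
  by rewrite scalerA -expr2 !addrA.
set a := x^T *m N *m x; set b := x^T *m N *m y in xy *.
set c := y^T *m N *m x in xy *; set e := y^T *m N *m y.
clearbody a b c e; by rewrite !mxE xy; ring.
Qed.

Lemma norm2_sqr (n : nat) (x : 'cV[R]_n) : norm2 x ^+ 2 = (x^T *m x) 0 0.
Proof.
rewrite sqr_sqrtr; last by apply: sumr_ge0 => i _; apply: sqr_ge0.
by rewrite mxE; apply: eq_bigr => i _; rewrite mxE expr2.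
Qed.

Lemma wnorm_sqr (n : nat) (P : 'M[R]_n) (x : 'cV[R]_n) :
  psd P -> wnorm P x ^+ 2 = (x^T *m P *m x) 0 0.
Proof. by move=> [_ P0]; rewrite sqr_sqrtr. Qed.

Lemma big_mxtens_index (m n : nat) (F : 'I_(m * n) -> R) :
  \sum_i F i = \sum_k \sum_a F (mxtens_index (k, a)).
Proof.
rewrite pair_bigA /= (reindex (@mxtens_index m n)) /=; last first.
  by exists (@mxtens_unindex m n) => ? _;
    rewrite ?mxtens_indexK ?mxtens_unindexK.
by apply: eq_bigr => -[].
Qed.

Lemma form_tens1 (L n : nat) (N : 'M[R]_n) (x : 'cV[R]_(L * n)) :
  (x^T *m tensmx (1%:M : 'M[R]_L) N *m x) 0 0 =
  \sum_(k < L) ((block x k)^T *m N *m block x k) 0 0.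
Proof.
rewrite form_sum big_mxtens_index; apply: eq_bigr => k _.
rewrite form_sum; apply: eq_bigr => a _.
rewrite big_mxtens_index (bigD1 k) //= [X in _ + X]big1 ?addr0 => [|l lk].
  by apply: eq_bigr => b _; rewrite tensmxE !mxE eqxx mul1r.
apply: big1 => b _.
by rewrite tensmxE mxE eq_sym (negbTE lk) !mul0r.
Qed.

Lemma psd_tens1 (L n : nat) (N : 'M[R]_n) :
  psd N -> psd (tensmx (1%:M : 'M[R]_L) N).
Proof.
move=> [sN N0]; split; first by rewrite trmx_tens trmx1 sN.
by move=> x; rewrite form_tens1; apply: sumr_ge0.
Qed.

Lemma wnorm_tens1 (L n : nat) (N : 'M[R]_n) (x : 'cV[R]_(L * n)) : psd N ->
  wnorm (tensmx (1%:M : 'M[R]_L) N) x ^+ 2 =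
  \sum_(k < L) wnorm N (block x k) ^+ 2.
Proof.
move=> pN; rewrite wnorm_sqr ?form_tens1; last exact: psd_tens1.
by apply: eq_bigr => k _; rewrite wnorm_sqr.
Qed.

Lemma block_stack (L n : nat) (x : 'I_L -> 'cV[R]_n) (k : 'I_L) :
  block (stack x) k = x k.
Proof. by apply/matrixP => i j; rewrite !mxE mxtens_indexK ord1. Qed.

Lemma blockB (L n : nat) (x y : 'cV[R]_(L * n)) (k : 'I_L) :
  block (x - y) k = block x k - block y k.
Proof. by apply/matrixP => i j; rewrite !mxE. Qed.

End QuadraticForms.

Section Expectation.
Local Open Scope ereal_scope.
Context (R : realType) (d : measure_display) (Omega : measurableType d).
Context (P : probability Omega R).

Lemma expectation_bigsum (I : Type) (s : seq I) (F : I -> Omega -> R) :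
  (forall i, F i \in Lfun P 1) ->
  ((fun w => \sum_(i <- s) F i w)%R \in Lfun P 1) /\
  'E_P[fun w => (\sum_(i <- s) F i w)%R] = \sum_(i <- s) 'E_P[F i].
Proof.
move=> F1; elim: s => [|i s [IH1 IH2]].
  rewrite (_ : (fun w => _) = cst 0%R); last first.
    by apply/funext => w; rewrite big_nil.
  by rewrite expectation_cst big_nil; split => //; apply: Lfun_cst.
have -> : (fun w => \sum_(j <- i :: s) F j w)%R =
  (F i \+ (fun w => \sum_(j <- s) F j w)%R)%R.
  by apply/funext => w; rewrite big_cons.
by split; [exact: rpredD | rewrite expectationD// big_cons IH2].
Qed.

Lemma has_mean_cov_shift (n : nat) (Y : Omega -> 'cV[R]_n) (mu c : 'cV[R]_n)
    (Sig : 'M[R]_n) :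
  has_mean_cov P Y mu Sig -> has_mean_cov P (fun w => Y w - c)%R (mu - c)%R Sig.
Proof.
move=> [L2 Emu Ecov].
have Pfin : P setT \is a fin_num := fin_num_measure P _ measurableT.
have L1 i := Lfun_subset12 Pfin (L2 i).
have cL2 r : cst r \in Lfun P 2%:E by exact: Lfun_cst.
have subL2 (f h : Omega -> R) :
    f \in Lfun P 2%:E -> h \in Lfun P 2%:E -> (f \- h)%R \in Lfun P 2%:E.
  by move=> f2 h2; rewrite rpredB ?lee1n.
have E i : (fun w => (Y w - c)%R i 0%R) = ((fun w => Y w i 0) \- cst (c i 0))%R.
  by apply/funext => w; rewrite !mxE.
split => [i|i|i j].
- by rewrite E subL2 ?L2 ?cL2.
- rewrite E expectationB ?expectation_cst ?Emu ?mxE// ; exact: Lfun_cst.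
- rewrite !E covarianceBr ?subL2 ?L2 ?cL2//.
  by rewrite covariance_cst_r sube0
    covarianceBl ?L2 ?cL2// covariance_cst_l sube0.
Qed.

Lemma expectation_form (n : nat) (Y : Omega -> 'cV[R]_n) (mu : 'cV[R]_n)
    (Sig N : 'M[R]_n) : N^T%R = N ->
  has_mean_cov P Y mu Sig ->
  'E_P[fun w => (((Y w)^T *m N *m Y w) 0 0)%R] =
  ((mu^T *m N *m mu) 0 0 + \tr (N *m Sig))%R%:E.
Proof.
move=> sN [L2 Emu Ecov].
have Pfin : P setT \is a fin_num := fin_num_measure P _ measurableT.
have L1 i := Lfun_subset12 Pfin (L2 i).
have YY1 i j := Lfun2_mul_Lfun1 (L2 i) (L2 j).
have EYY i j : 'E_P[(fun w => Y w i 0) * (fun w => Y w j 0)]%R =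
    (Sig i j + mu i 0 * mu j 0)%R%:E.
  have := Ecov i j; rewrite covarianceE ?L1 ?YY1// (Emu i) (Emu j).
  rewrite -(fineK (expectation_fin_num (YY1 i j))) -EFinM -EFinB => -[<-].
  by rewrite subrK.
have Nsym i j : N i j = N j i by rewrite -[in LHS]sN mxE.
pose G i j := (N i j \o* ((fun w => Y w i 0%R) * (fun w => Y w j 0%R)))%R.
have G1 i j : G i j \in Lfun P 1.
  by apply: Lfun_scale; rewrite ?YY1 ?ler01 ?lexx.
have H i := expectation_bigsum (index_enum 'I_n) (G1 i).
have [_ K] := expectation_bigsum (index_enum 'I_n) (fun i => (H i).1).
transitivity ('E_P[fun w => (\sum_i \sum_j G i j w)%R]).
  congr expectation; apply/funext => w; rewrite form_sum.
  by apply: eq_bigr => i _; apply: eq_bigr => j _; rewrite mulrC.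
rewrite K.
rewrite (eq_bigr (fun i => (\sum_j N i j * (Sig i j + mu i 0 * mu j 0))%R%:E)).
  rewrite sumEFin; congr EFin.
  rewrite form_sum addrC /mxtrace exchange_big -big_split /=.
  apply: eq_bigr => i _; rewrite mxE -big_split /=; apply: eq_bigr => j _.
  rewrite -(Nsym i j); ring.
move=> i _; rewrite (H i).2 -sumEFin; apply: eq_bigr => j _.
by rewrite expectationZl ?(EYY i j) ?YY1.
Qed.

End Expectation.

Section Predictor.
Context (R : realType) (p m M : nat).
Context (Psi : 'M[R]_(p, M)) (Yp : 'M[R]_(m, M)) (S : 'M[R]_m).

Definition definite (n : nat) (N : 'M[R]_n) : Prop :=
  forall x : 'cV[R]_n, (x^T *m N *m x) 0 0 = 0 -> x = 0.

Lemma definite_unitmx (n : nat) (N : 'M[R]_n) : definite N -> N \in unitmx.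
Proof.
move=> dN; rewrite -row_free_unit; apply: inj_row_free => v vN.
by apply: trmx_inj; rewrite trmx0 (dN v^T)// trmxK vN mul0mx mxE.
Qed.

Lemma gram_unitmx (N : 'M[R]_M) : definite N -> row_free Psi ->
  Psi *m invmx N *m Psi^T \in unitmx.
Proof.
move=> dN fPsi; have uN := definite_unitmx dN.
apply: definite_unitmx => x x0.
pose z : 'cV_M := invmx N *m (Psi^T *m x).
have zN : N *m z = Psi^T *m x by rewrite mulKVmx.
have z0 : z = 0.
  apply: dN; rewrite -mulmxA zN.
  have -> : z^T *m (Psi^T *m x) = (x^T *m (Psi *m invmx N *m Psi^T) *m x)^T.
    by rewrite !trmx_mul !trmxK !mulmxA.
  by rewrite mxE.
apply: trmx_inj; apply: (row_free_inj fPsi).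
by apply: trmx_inj; rewrite trmx0 mul0mx trmx0 trmx_mul trmxK -zN z0 mulmx0.
Qed.

Lemma norm2_definite (n : nat) (x : 'cV[R]_n) : (x^T *m x) 0 0 = 0 -> x = 0.
Proof.
rewrite mxE => /psumr_eq0P x0; apply/matrixP => i j; rewrite ord1 !mxE.
have /eqP : x^T 0 i * x i 0 = 0.
  by apply: x0 => // k _; rewrite mxE -expr2 sqr_ge0.
by rewrite mxE mulf_eq0 orbb => /eqP.
Qed.

Lemma form_F_mx (lambda : R) (x : 'cV[R]_M) :
  (x^T *m F_mx Yp S lambda *m x) 0 0 =
  lambda * (x^T *m x) 0 0 + ((Yp *m x)^T *m S *m (Yp *m x)) 0 0.
Proof.
rewrite /F_mx mulmxDr mulmxDl mul_mx_scalar -scalemxAl trmx_mul !mulmxA.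
by rewrite [LHS]mxE; congr (_ + _); rewrite [LHS]mxE.
Qed.

Lemma norm2_ge0 (n : nat) (x : 'cV[R]_n) : 0 <= (x^T *m x) 0 0.
Proof. by rewrite -norm2_sqr sqr_ge0. Qed.

Lemma F_mx_definite (lambda : R) : psd S -> 0 < lambda ->
  definite (F_mx Yp S lambda).
Proof.
move=> [_ S0] l0 x; rewrite form_F_mx => /eqP.
rewrite paddr_eq0 ?S0 ?mulr_ge0 ?norm2_ge0 ?ltW// => /andP[+ _].
by rewrite mulf_eq0 gt_eqF//= => /eqP /norm2_definite.
Qed.

(* Psi^+ d is orthogonal to ker Psi, so g = Psi^+ d + h turns the problem with
   y = 0 into the one with constraint Psi h = 0 and target - Y_p Psi^+ d, whose
   solution is - R_4 Y_p Psi^+ d. *)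
Lemma gain_Psi_pinv (lambda : R) : psd S -> 0 < lambda -> row_free Psi ->
  let Pinv := Psi^T *m invmx (Psi *m Psi^T) in
  gain_Psi Psi Yp S lambda =
  Pinv - gain_y Psi Yp S lambda *m Yp *m Pinv.
Proof.
move=> pS l0 fPsi Pinv.
have dF := F_mx_definite pS l0; have uF := definite_unitmx dF.
have uW := gram_unitmx dF fPsi.
have uG : Psi *m Psi^T \in unitmx.
  have d1 : definite (1%:M : 'M[R]_M).
    by move=> x; rewrite mulmx1 => /norm2_definite.
  by have := gram_unitmx d1 fPsi; rewrite invmx1 mulmx1.
rewrite /gain_y /gain_Psi /=.
set F := F_mx Yp S lambda in dF uF uW *; set Fi := invmx F in uW *.
set W := invmx _ in uW *.
have PsiPinv : Psi *m Pinv = 1%:M by rewrite mulmxA mulmxV.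
set K := Fi - _.
have KF : K *m F = 1%:M - Fi *m Psi^T *m W *m Psi.
  by rewrite mulmxBl mulVmx// mulmxKV.
have KPsi : K *m Psi^T = 0.
  rewrite mulmxBl; apply/eqP; rewrite subr_eq0 eq_sym; apply/eqP.
  transitivity (Fi *m Psi^T *m W *m (Psi *m Fi *m Psi^T)).
    by rewrite !mulmxA.
  by rewrite mulmxKV.
have -> : K *m Yp^T *m S *m Yp = K *m F - lambda *: K.
  by rewrite /F /F_mx mulmxDr mul_mx_scalar addrC addKr !mulmxA.
rewrite mulmxBl KF -scalemxAl [K *m Pinv]mulmxA KPsi mul0mx scaler0 subr0.
by rewrite mulmxBl mul1mx -(mulmxA _ Psi) PsiPinv mulmx1 opprB addrC subrK.
Qed.

Lemma gain_Psi_annihilated (q : nat) (N : 'M[R]_(q, M)) (lambda : R) :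
    psd S -> 0 < lambda -> row_free Psi ->
    N *m gain_y Psi Yp S lambda = 0 ->
  N *m gain_Psi Psi Yp S lambda = N *m (Psi^T *m invmx (Psi *m Psi^T)).
Proof.
move=> pS l0 fPsi N0; rewrite gain_Psi_pinv//.
move: (gain_y _ _ _ _) N0 => G N0.
by rewrite mulmxBr !(mulmxA N) N0 !mul0mx subr0.
Qed.

Lemma minimizer_stationary (lambda : R) (d : 'cV[R]_p) (y : 'cV[R]_m)
    (g k : 'cV[R]_M) :
  psd S -> 0 < lambda -> is_minimizer Psi Yp S lambda d y g -> Psi *m k = 0 ->
  k^T *m (F_mx Yp S lambda *m g - Yp^T *m S *m y) = 0.
Proof.
move=> pS l0 [gd gmin] k0.
set e := k^T *m _; have [sS S0] := pS.
pose b := (k^T *m F_mx Yp S lambda *m k) 0 0.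
have b0 : 0 <= b.
  by rewrite /b form_F_mx addr_ge0 ?S0// mulr_ge0 ?norm2_ge0 ?ltW.
have quad s : 0 <= s * (2 * e 0 0) + s ^+ 2 * b.
  have := gmin (g + s *: k); rewrite mulmxDr -scalemxAr k0 scaler0 addr0.
  move=> /(_ gd); rewrite !wnorm_sqr// !norm2_sqr.
  have -> : Yp *m (g + s *: k) - y = (Yp *m g - y) + s *: (Yp *m k).
    by rewrite mulmxDr -scalemxAr addrAC.
  rewrite form_shift//.
  have := @form_shift R M 1%:M g k s (trmx1 _ _); rewrite !mulmx1 => ->.
  have -> : e 0 0 = ((Yp *m k)^T *m S *m (Yp *m g - y)) 0 0 +
      lambda * (k^T *m g) 0 0.
    rewrite /e /F_mx.
    have -> : k^T *m ((lambda%:M + Yp^T *m S *m Yp) *m g - Yp^T *m S *m y) =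
      (Yp *m k)^T *m S *m (Yp *m g - y) + lambda *: (k^T *m g).
      rewrite mulmxDl mul_scalar_mx !mulmxBr !mulmxDr trmx_mul !mulmxA.
      by rewrite -scalemxAr -addrA addrC.
    by rewrite [LHS]mxE; congr (_ + _); rewrite mxE.
  rewrite /b form_F_mx; lra.
suff e00 : e 0 0 = 0.
  by apply/matrixP => i j; rewrite (ord1 i) (ord1 j) e00 [RHS]mxE.
apply/eqP; rewrite -sqrf_eq0 eq_le sqr_ge0 andbT.
have := quad (- e 0 0 / (b + 1)).
have b1 : 0 < b + 1 by lra.
have -> : - e 0 0 / (b + 1) * (2 * e 0 0) + (- e 0 0 / (b + 1)) ^+ 2 * b =
  - (e 0 0 ^+ 2) * ((b + 2) / (b + 1) ^+ 2) by field; lra.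
by rewrite pmulr_lge0 ?oppr_ge0// divr_gt0 ?exprn_gt0//; lra.
Qed.

Lemma stationary_unique (lambda : R) (z : 'cV[R]_M)
    (g h : 'cV[R]_M) : definite (F_mx Yp S lambda) ->
  Psi *m g = Psi *m h ->
  (forall k : 'cV_M, Psi *m k = 0 -> k^T *m (F_mx Yp S lambda *m g - z) = 0) ->
  (forall k : 'cV_M, Psi *m k = 0 -> k^T *m (F_mx Yp S lambda *m h - z) = 0) ->
  g = h.
Proof.
move=> dF gh sg sh; apply/eqP; rewrite -subr_eq0; apply/eqP/dF.
have Pgh : Psi *m (g - h) = 0 by rewrite mulmxBr gh subrr.
have := congr2 (fun a b => a - b) (sg _ Pgh) (sh _ Pgh).
rewrite -mulmxBr subr0 opprB addrA subrK -mulmxBr mulmxA => ->.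
by rewrite mxE.
Qed.

End Predictor.

(* When lambda varies with the designed input, so do the gains; but N R_3 does
   not as soon as N annihilates R_4. *)
Lemma R3_mx_annihilated (R : realType) (n pu pw m M q : nat)
    (Psi : 'M[R]_(pu + pw, M)) (Yp : 'M[R]_(m, M)) (S : 'M[R]_m)
    (reg : regularization R n) (N : 'M[R]_(q, M)) :
  psd S -> reg_positive reg -> row_free Psi ->
  (forall u, N *m R4_mx Psi Yp S reg u = 0) ->
  forall u v, N *m R3_mx Psi Yp S reg u = N *m R3_mx Psi Yp S reg v.
Proof.
case: reg => [lambda|//] pS /= l0 fPsi NR4 u v.
have E w := gain_Psi_annihilated pS (l0 w) fPsi (NR4 w).
by rewrite /R3_mx /at_reg !mulmx_rsub (E u) (E v).
Qed.

Section Affine.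
Context (R : realType).

Definition affine (n q : nat) (f : 'cV[R]_n -> 'cV[R]_q) : Prop :=
  forall u, f u = f 0 + \sum_j u j 0 *: (f (delta_mx j 0) - f 0).

Lemma affine_mx (n q : nat) (f : 'cV[R]_n -> 'cV[R]_q) : affine f ->
  exists G : 'M[R]_(q, n), forall u, f u = G *m u + f 0.
Proof.
move=> af; exists (\matrix_(i, j) (f (delta_mx j 0) i 0 - f 0 i 0)) => u.
rewrite {1}af addrC; congr (_ + _); apply/matrixP => i k; rewrite ord1.
rewrite summxE mxE; apply: eq_bigr => j _.
by rewrite !mxE mulrC.
Qed.

Lemma affine_cst (n q : nat) (b : 'cV[R]_q) : affine (fun _ : 'cV[R]_n => b).
Proof. by move=> u; rewrite big1 ?addr0// => j _; rewrite subrr scaler0. Qed.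

Lemma affine_id (n : nat) : affine (fun u : 'cV[R]_n => u).
Proof.
move=> u; rewrite add0r {1}[u]matrix_sum_delta; apply: eq_bigr => j _.
by rewrite big_ord1 subr0.
Qed.

Lemma affineB (n q : nat) (f h : 'cV[R]_n -> 'cV[R]_q) :
  affine f -> affine h -> affine (fun u => f u - h u).
Proof.
move=> af ah u; rewrite af ah opprD addrACA -sumrB; congr (_ + _).
by apply: eq_bigr => j _; rewrite -scalerBr !opprB addrACA
  [in RHS]addrACA [in RHS](addrC (- _)).
Qed.

Lemma affine_mulmx (n q k : nat) (B : 'M[R]_(k, q)) (f : 'cV[R]_n -> 'cV[R]_q) :
  affine f -> affine (fun u => B *m f u).
Proof.
move=> af u; rewrite af mulmxDr mulmx_sumr; congr (_ + _).
by apply: eq_bigr => j _; rewrite -scalemxAr mulmxBr.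
Qed.

Lemma affine_pred_mean (n mp mf k : nat) (Yp : 'M[R]_(mp, k))
    (Yf : 'M[R]_(mf, k)) (Gam : 'M[R]_(mf, mp)) (y : 'cV[R]_mp)
    (g : 'cV[R]_n -> 'cV[R]_k) :
  affine g -> affine (fun u => pred_mean Yp Yf Gam y (g u)).
Proof.
move=> ag; apply: affineB; first exact: affine_mulmx.
by apply/affine_mulmx/affineB; [exact: affine_mulmx | exact: affine_cst].
Qed.

Lemma affine_col_mx (n p q : nat) (f : 'cV[R]_n -> 'cV[R]_p)
    (h : 'cV[R]_n -> 'cV[R]_q) :
  affine f -> affine h -> affine (fun u => col_mx (f u) (h u)).
Proof.
move=> af ah u; rewrite -[RHS]vsubmxK; congr col_mx.
  rewrite [RHS](raddfD (usubmx)) raddf_sum /= col_mxKu [LHS]af; congr (_ + _).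
  apply: eq_bigr => j _.
  by rewrite [RHS]linearZ /= (raddfB usubmx) /= !col_mxKu.
rewrite [RHS](raddfD (dsubmx)) raddf_sum /= col_mxKd [LHS]ah; congr (_ + _).
apply: eq_bigr => j _.
by rewrite [RHS]linearZ /= (raddfB dsubmx) /= !col_mxKd.
Qed.

Lemma affine_lim (n q : nat) (h : 'cV[R]_n -> R -> 'cV[R]_q)
    (g : 'cV[R]_n -> 'cV[R]_q) :
  (forall l, 0 < l -> affine (h^~ l)) ->
  (forall u, h u l @[l --> 0^'+] --> g u) -> affine g.
Proof.
move=> ah hg u; apply/matrixP => i k; rewrite ord1 {k}.
have hgi v : h v l i 0 @[l --> 0^'+] --> g v i 0.
  by apply: (cvg_comp (h v) (fun x : 'cV[R]_q => x i 0) (hg v));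
    exact: coord_continuous.
have : h 0 l i 0 + \sum_j u j 0 * (h (delta_mx j 0) l i 0 - h 0 l i 0)
    @[l --> 0^'+] --> g 0 i 0 + \sum_j u j 0 * (g (delta_mx j 0) i 0 - g 0 i 0).
  apply: cvgD => //; apply: cvg_big => [|j _]; first exact: add_continuous.
  by apply: cvgMr; apply: cvgB.
rewrite mxE summxE => lim.
have -> : \sum_j (u j 0 *: (g (delta_mx j 0) - g 0)) i 0 =
    \sum_j u j 0 * (g (delta_mx j 0) i 0 - g 0 i 0).
  by apply: eq_bigr => j _; rewrite !mxE.
apply: (cvg_unique _ (hgi u)) => //.
apply: cvg_trans lim; apply: near_eq_cvg.
near=> l.
rewrite [in RHS](ah l)// mxE summxE; congr (_ + _); apply: eq_bigr => j _.
by rewrite !mxE.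
Unshelve. all: by end_near.
Qed.

Section Minimizer.
Context (n p m M : nat).
Context (Psi : 'M[R]_(p, M)) (Yp : 'M[R]_(m, M)) (S : 'M[R]_m).
Context (d : 'cV[R]_n -> 'cV[R]_p) (y : 'cV[R]_m).

Lemma affine_minimizer (lambda : R) (g : 'cV[R]_n -> 'cV[R]_M) :
  psd S -> 0 < lambda -> affine d ->
  (forall u, is_minimizer Psi Yp S lambda (d u) y (g u)) -> affine g.
Proof.
move=> pS l0 ad gmin u.
have stat v k := minimizer_stationary (k := k) pS l0 (gmin v).
apply: (@stationary_unique _ _ _ _ Psi Yp S lambda (Yp^T *m S *m y)).
- exact: F_mx_definite.
- rewrite (gmin u).1 ad mulmxDr (gmin 0).1 mulmx_sumr; congr (_ + _).
  apply: eq_bigr => j _.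
  by rewrite -scalemxAr mulmxBr (gmin 0).1 (gmin (delta_mx j 0)).1.
- exact: stat.
move=> k k0; set z := Yp^T *m S *m y in stat *.
set F := F_mx Yp S lambda in stat *.
rewrite (mulmxDr F) addrAC mulmxDr stat// add0r !mulmx_sumr big1// => j _.
have -> : F *m (u j 0 *: (g (delta_mx j 0) - g 0)) =
    u j 0 *: ((F *m g (delta_mx j 0) - z) - (F *m g 0 - z)).
  by rewrite -scalemxAr mulmxBr opprB addrA subrK.
by rewrite -scalemxAr mulmxBr !stat// subr0 scaler0.
Qed.

Lemma affine_predictor (reg : regularization R n) (g : 'cV[R]_n -> 'cV[R]_M) :
  psd S -> reg_positive reg -> reg_constant reg -> affine d ->
  (forall u, is_predictor Psi Yp S reg d y u (g u)) -> affine g.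
Proof.
case: reg => [lambda|] pS /= l0 lc ad gP.
  apply: (affine_minimizer pS (l0 0) ad) => u; rewrite (lc 0 u); exact: gP.
have [h hP] := choice gP.
apply: (@affine_lim _ _ h g) => [l lp|u]; last exact: (hP u).2.
by apply: (affine_minimizer pS lp ad) => u; exact: (hP u).1.
Qed.

End Minimizer.

Lemma quadratic_add (n : nat) (f h : 'cV[R]_n -> R) :
  quadratic (EFin \o f) -> quadratic (EFin \o h) ->
  quadratic (EFin \o (f \+ h)).
Proof.
move=> [H1 [h1 [c1 E1]]] [H2 [h2 [c2 E2]]].
exists (H1 + H2), (h1 + h2), (c1 + c2) => u /=.
have [-> ->] : f u = (u^T *m H1 *m u) 0 0 + (h1^T *m u) 0 0 + c1 /\
  h u = (u^T *m H2 *m u) 0 0 + (h2^T *m u) 0 0 + c2.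
  by split; [case: (E1 u) | case: (E2 u)].
have -> : (h1 + h2)^T = h1^T + h2^T by apply/matrixP => i j; rewrite !mxE.
rewrite mulmxDr !mulmxDl; congr EFin.
move: (_ *m H1 *m _) (_ *m H2 *m _) (h1^T *m _) (h2^T *m _) => x y z t.
by rewrite !mxE; ring.
Qed.

Lemma quadratic_scale (n : nat) (a : R) (f : 'cV[R]_n -> R) :
  quadratic (EFin \o f) -> quadratic (EFin \o (fun u => a * f u)).
Proof.
move=> [H [h [c E]]]; exists (a *: H), (a *: h), (a * c) => u /=.
have [->] := E u.
have -> : (a *: h)^T = a *: h^T by apply/matrixP => i j; rewrite !mxE.
rewrite -scalemxAr -!scalemxAl; congr EFin.
move: (_ *m H *m _) (h^T *m _) => x y.
by rewrite !mxE; ring.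
Qed.

Lemma quadratic_cst (n : nat) (a : R) :
  quadratic (EFin \o (fun _ : 'cV[R]_n => a)).
Proof.
exists 0, 0, a => u; congr EFin.
by rewrite trmx0 mulmx0 !mul0mx !mxE !add0r.
Qed.

Lemma quadratic_form_affine (n q : nat) (N : 'M[R]_q)
    (f : 'cV[R]_n -> 'cV[R]_q) :
  affine f -> 
  quadratic (EFin \o (fun u => ((f u)^T *m N *m f u) 0 0)).
Proof.
move=> /affine_mx[G fE]; set b := f 0 in fE.
exists (G^T *m N *m G), (G^T *m N^T *m b + G^T *m N *m b),
  ((b^T *m N *m b) 0 0) => u.
congr EFin; rewrite fE.
have -> : (G *m u + b)^T = u^T *m G^T + b^T.
  by rewrite -trmx_mul; apply/matrixP => i j; rewrite !mxE.
have -> : (G^T *m N^T *m b + G^T *m N *m b)^T = b^T *m N *m G + b^T *m N^T *m G.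
  by rewrite [LHS]raddfD /= !trmx_mul !trmxK !mulmxA.
have E : u^T *m G^T *m N *m b = (b^T *m N^T *m G *m u)^T.
  by rewrite !trmx_mul !trmxK !mulmxA.
rewrite !mulmxDl !mulmxDr !mulmxA E.
move: (b^T *m N^T *m G *m u) (b^T *m N *m G *m u) (b^T *m N *m b) (_ *m u)
  => x y z t.
by rewrite !mxE; ring.
Qed.

End Affine.

Theorem lemma6 (R : realType) (nx nu nw ny L0 L' M : nat)
    (A : 'M[R]_nx) (C : 'M[R]_(ny, nx)) (sigma : R)
    (Psi : 'M[R]_(L0 * nu + L' * nu + (L0 + L') * nw, M))
    (Yp : 'M[R]_(L0 * ny, M)) (Yf : 'M[R]_(L' * ny, M))
    (S : 'M[R]_(L0 * ny)) (reg : regularization R (L' * nu))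
    (u_ini : 'cV[R]_(L0 * nu)) (wbar : 'cV[R]_((L0 + L') * nw))
    (Sw : 'M[R]_((L0 + L') * nw)) (y_ini : 'cV[R]_(L0 * ny))
    (Pt : 'M[R]_(L0 * ny))
    (Q : 'M[R]_ny) (Rc : 'M[R]_nu) (r : 'I_L' -> 'cV[R]_ny)
    (g : 'cV[R]_(L' * nu) -> 'cV[R]_M)
    (d : measure_display) (Omega : measurableType d)
    (P : 'cV[R]_(L' * nu) -> probability Omega R)
    (yhat : 'cV[R]_(L' * nu) -> Omega -> 'cV[R]_(L' * ny)) :
  let Gam := auto_mx A C L0 L' in
  let R3 := R3_mx Psi Yp S reg in
  let R4 := R4_mx Psi Yp S reg in
  let ybar u := pred_mean Yp Yf Gam y_ini (g u) in
  let Sigma u := pred_cov sigma Yp Yf Gam (R3 u) Pt Sw (g u) in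
  let T := noise_mx sigma Gam in
  let Qbar := tensmx (1%:M : 'M[R]_L') Q in
  let Rbar := tensmx (1%:M : 'M[R]_L') Rc in
  let J u := control_cost (P u) Q Rc r u (yhat u) in
  schur_stable A ->
  \rank (obs_mx A C 0 L0) = nx ->
  psd Sw -> psd Pt -> psd Q -> psd Rc -> psd S ->
  reg_positive reg ->
  row_free Psi ->
  (forall u, Yp *m R4 u \in unitmx) ->
  (forall u, Gam = Yf *m R4 u *m invmx (Yp *m R4 u)) ->
  (forall u, is_predictor Psi Yp S reg
     (fun v => col_mx (col_mx u_ini v) wbar) y_ini u (g u)) ->
  (forall u, has_mean_cov (P u) (yhat u) (ybar u) (Sigma u)) ->
  (exists c : R, forall u,
     J u = (wnorm Rbar u ^+ 2 + wnorm Qbar (ybar u - stack r) ^+ 2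
            + \tr (Qbar *m T) * norm2 (g u) ^+ 2 + c)%:E) /\
  (reg_constant reg -> quadratic J).
Proof.
move=> Gam R3 R4 ybar Sigma T Qbar Rbar J _ _ pSw pPt pQ pRc pS reg0 fPsi
  uR4 GamE gP YP.
pose N := Yf - Gam *m Yp.
have NR3 u : N *m R3 u = N *m R3 0.
  apply: R3_mx_annihilated => // v.
  by rewrite mulmxBl -mulmxA {1}(GamE v) mulmxKV ?subrr.
pose Sig0 := Gam *m Pt *m Gam^T + N *m R3 0 *m Sw *m (N *m R3 0)^T.
have pQbar : psd Qbar by exact: psd_tens1.
have JE u : J u = (wnorm Rbar u ^+ 2 + wnorm Qbar (ybar u - stack r) ^+ 2
            + \tr (Qbar *m T) * norm2 (g u) ^+ 2 + \tr (Qbar *m Sig0))%:E.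
  rewrite /J /control_cost.
  have -> : (fun w => \sum_(k < L') wnorm Q (block (yhat u w) k - r k) ^+ 2) =
    (fun w => ((yhat u w - stack r)^T *m Qbar *m (yhat u w - stack r)) 0 0).
    apply/funext => w; rewrite -wnorm_sqr// wnorm_tens1//.
    by apply: eq_bigr => k _; rewrite blockB block_stack.
  rewrite (expectation_form pQbar.1 (has_mean_cov_shift (stack r) (YP u))).
  rewrite -EFinD -wnorm_tens1// -wnorm_sqr//; congr EFin.
  rewrite -!addrA; congr (_ + (_ + _)).
  rewrite /Sigma /pred_cov -/N NR3 -/T -/Sig0 mulmxDr mxtraceD -scalemxAr.
  by rewrite mxtraceZ addrC mulrC.
split; first by exists (\tr (Qbar *m Sig0)).
move=> regc.
have ag : affine g.
  apply: (affine_predictor pS reg0 regc _ gP); apply: affine_col_mx.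
    by apply: affine_col_mx; [exact: affine_cst | exact: affine_id].
  exact: affine_cst.
have ay : affine (fun u => ybar u - stack r).
  by apply: affineB; [apply: affine_pred_mean | exact: affine_cst].
have -> : J = EFin \o ((((fun u => (u^T *m Rbar *m u) 0 0) \+
    (fun u => ((ybar u - stack r)^T *m Qbar *m (ybar u - stack r)) 0 0)) \+
    (fun u => \tr (Qbar *m T) * ((g u)^T *m 1%:M *m g u) 0 0)) \+
    (fun=> \tr (Qbar *m Sig0))).
  apply/funext => u; rewrite JE /= mulmx1 norm2_sqr !wnorm_sqr//.
  exact: psd_tens1.
apply: quadratic_add; last exact: quadratic_cst.
apply: quadratic_add; last first.
  by apply: quadratic_scale; exact: quadratic_form_affine.
apply: quadratic_add; last exact: quadratic_form_affine.
exact: (quadratic_form_affine Rbar (@affine_id R _)).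
Qed.
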